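(* Let $A\in\mathbb{R}^{n\times n}$ have distinct eigenvalues $\lambda_1,\dots,\lambda_p$ with geometric multiplicities $k_1,\dots,k_p$, let $k_{\max}=\max_{1\le i\le p}k_i$, and let $\mathcal{X}_a\subseteq\{1,\dots,n\}$ be an accessible state set. Then: (1) there exist feasible solutions to the minimal input controllability problem (MICP) with accessible state set $\mathcal{X}_a$ only if for each $i=1,\dots,p$ there exists an $h_i\in H_i$ such that $h_i\subseteq\mathcal{X}_a$; (2) if the condition in (1) is satisfied, then the minimal number of inputs ensuring system controllability (with accessible state set $\mathcal{X}_a$) is $k_{\max}$.
   Context: $(A,B)$ controllable refers to the system $\dot x(t)=Ax(t)+Bu(t)$ with $B$ real. The MICP with accessible state set $\mathcal{X}_a$ is: find a real matrix $B$ with $n$ rows such that $(A,B)$ is controllable, every nonzero row of $B$ has its index in $\mathcal{X}_a$ (only states in $\mathcal{X}_a$ can be directly actuated by inputs), and the number of nonzero columns (inputs) of $B$ is minimal. A feasible solution is any $B$ satisfying the first two requirements. For each eigenvalue $\lambda_i$, $k_i=n-\mathrm{rank}(\lambda_iI-A)$, and $X_i\in\mathbb{C}^{n\times k_i}$ has linearly independent columns spanning the left null space of $\lambda_iI-A$ (so $X_i^{\intercal}(\lambda_iI-A)=0$). With $X_{i\mathcal{J}}^{\intercal}$ the columns of $X_i^{\intercal}$ indexed by $\mathcal{J}$, $H_i=\{\mathcal{J}\subseteq\{1,\dots,n\}:|\mathcal{J}|=k_i,\ X_{i\mathcal{J}}^{\intercal}\text{ has full row rank}\}$, which does not depend on the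 choice of $X_i$. *)

(* Defs.v *)
From HB Require Import structures.
From mathcomp Require Import all_boot all_order all_algebra.
From mathcomp Require Import complex.
From mathcomp Require Import all_classical all_reals all_analysis.

Set Implicit Arguments.
Unset Strict Implicit.
Unset Printing Implicit Defensive.

Import Order.TTheory GRing.Theory Num.Theory.
Import numFieldNormedType.Exports.

Local Open Scope classical_set_scope.
Local Open Scope ring_scope.

(* x is a solution on [0, T] of x' = A x + B u for the input u.  Derivatives
   are only required inside the interval; continuity up to the endpoints gives
   x 0 and x T their meaning as initial and final states. *)
Definition trajectory (R : realType) (n m : nat) (A : 'M[R]_n)
    (B : 'M[R]_(n, m)) (T : R) (u : R -> 'cV[R]_m) (x : R -> 'cV[R]_n) : Prop :=
  {within `[0, T], continuous x} /\
  (forall t : R, 0 < t < T -> is_derive t 1 x (A *m x t + B *m u t)).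

(* Every initial state can be steered to every final state in finite time.  For
   linear time-invariant systems, replacing continuous inputs by piecewise
   continuous or integrable ones yields the same notion. *)
Definition controllable (R : realType) (n m : nat) (A : 'M[R]_n)
    (B : 'M[R]_(n, m)) : Prop :=
  forall x0 x1 : 'cV[R]_n,
    exists (T : R) (u : R -> 'cV[R]_m) (x : R -> 'cV[R]_n),
      [/\ 0 < T, {within `[0, T], continuous u}, trajectory A B T u x,
          x 0 = x0 & x T = x1].

Definition feasible (R : realType) (n m : nat) (A : 'M[R]_n)
    (Xa : {set 'I_n}) (B : 'M[R]_(n, m)) : Prop :=
  controllable A B /\ (forall i : 'I_n, row i B != 0 -> i \in Xa).

Definition num_inputs (R : realType) (n m : nat) (B : 'M[R]_(n, m)) : nat :=
  #|[set j : 'I_m | col j B != 0]%SET|.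

Definition minimal_num_inputs (R : realType) (n : nat) (A : 'M[R]_n)
    (Xa : {set 'I_n}) (k : nat) : Prop :=
  (exists (m : nat) (B : 'M[R]_(n, m)), feasible A Xa B /\ num_inputs B = k) /\
  (forall (m : nat) (B : 'M[R]_(n, m)), feasible A Xa B -> (k <= num_inputs B)%N).

Definition complexify (R : realType) (n : nat) (A : 'M[R]_n) : 'M[R[i]]_n :=
  map_mx (real_complex R) A.

Definition geom_mult (R : realType) (n : nat) (A : 'M[R]_n) (z : R[i]) : nat :=
  (n - \rank (z%:M - complexify A)%R)%N.

(* The columns of X are linearly independent and span the left null space of
   z I - A.  Row spaces being the primitive notion for matrices, this is said
   of the rows of X^T; kermx M is the row space of all v with v *m M = 0. *)
Definition left_null_basis (R : realType) (n k : nat) (A : 'M[R]_n) (z : R[i])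
    (X : 'M[R[i]]_(n, k)) : Prop :=
  row_free X^T /\ (X^T == kermx (z%:M - complexify A))%MS.

(* Columns indexed by J, in increasing order. *)
Definition cols_of (F : fieldType) (k n : nat) (M : 'M[F]_(k, n))
    (J : {set 'I_n}) : 'M[F]_(k, #|J|) :=
  colsub (fun j : 'I_#|J| => enum_val j) M.

(* For a k-row matrix, row_free means full row rank k. *)
Definition H (F : fieldType) (n k : nat) (X : 'M[F]_(n, k)) : {set {set 'I_n}} :=
  [set J : {set 'I_n} | (#|J| == k) && row_free (cols_of X^T J)]%SET.

(* Main.v *)
Require Import Defs.
From HB Require Import structures.
From mathcomp Require Import all_boot all_order all_algebra.
From mathcomp Require Import complex.
From mathcomp Require Import all_classical all_reals all_analysis.
From mathcomp Require Import ring.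

(** Both parts go through the Popov-Belevitch-Hautus (PBH) test: the pair (A, B)
    is controllable if and only if no nonzero complex left eigenvector q of A
    satisfies q B = 0.

    Controllability implies the test because q x(t) obeys the scalar equation
    w' = z w as soon as q A = z q and q B = 0, so starting from x(0) = 0 it stays
    at 0 and q vanishes on every reachable state
    (controllable_uncontrolled_mode_free).

    The converse is proved without matrix exponentials or Gramians, by flat
    outputs.  With chi the characteristic polynomial of A, the matrix
    adj(s I - A) is a polynomial in s with coefficients W_{k+1}, where W_k is the
    quotient of chi by s^k evaluated at A.  For any smooth y, setting
      x = sum_k W_{k+1} B y^(k)   and   u = chi(d/dt) y
    gives x' = A x + B u.  The test says that the columns of the W_{k+1} B
    span the whole state space (krylov_eq0, horner_tail_krylov), so x(0) and x(1)
    can be prescribed by prescribing finitely many derivatives of y at 0 and at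
    1, which a polynomial y can always meet (hermite_interpolation).

    The left eigenvectors for lambda_i are the row vectors c X_i^T, so the test
    reads: X_i^T B has full row rank k_i for every i.  This gives
      - k_i <= rank B <= number of nonzero columns of B, the lower bound;
      - if the rows of B outside Xa vanish, then the columns of X_i^T indexed by
        Xa already have rank k_i, and a maximal independent family of them is an
        element of H_i (H_subsetP), which is part (1);
      - conversely, if these columns have rank k_i for all i, then a matrix B
        with k_max columns is built one column at a time, raising the rank of
        every X_i^T B that is still below k_i (generic_actuation).  The new
        column has to avoid finitely many proper subspaces; a point of the
        moment curve with a suitable integer parameter does. *)

Set Implicit Arguments.
Unset Strict Implicit.
Unset Printing Implicit Defensive.

Import Order.TTheory GRing.Theory Num.Theory.
Import numFieldNormedType.Exports.

Local Open Scope ring_scope.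

(** * Derivatives of matrix-valued functions *)

Lemma is_derive_mx (R : realFieldType) (V : normedModType R) (m n : nat)
    (M : V -> 'M[R]_(m, n)) (D : 'M[R]_(m, n)) (t v : V) :
  is_derive t v M D <-> forall i j, is_derive t v (fun s => M s i j) (D i j).
Proof.
split=> [[dM DM] i j|dM].
  split; first by move/derivable_mxP: dM.
  by rewrite -DM derive_mx// mxE.
have dM' : derivable M t v by apply/derivable_mxP => i j; case: (dM i j).
split=> //; rewrite derive_mx//; apply/matrixP => i j; rewrite mxE.
by case: (dM i j).
Qed.

Lemma is_derive_mulmx (R : realFieldType) (V : normedModType R) (m n p : nat)
    (N : 'M[R]_(m, n)) (f : V -> 'M[R]_(n, p)) (D : 'M[R]_(n, p)) (t v : V) :
  is_derive t v f D -> is_derive t v (fun s => N *m f s) (N *m D).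
Proof.
move=> /is_derive_mx fD; apply/is_derive_mx => i j.
have -> : (fun s => (N *m f s) i j) =
    \sum_(k < n) (N i k \*: (fun s => f s k j)).
  by apply/funext => s; rewrite mxE fct_sumE.
by rewrite mxE; apply: is_derive_sum => k; exact: is_deriveZ.
Qed.

Lemma is_derive_continuous (R : realType) (V : normedModType R)
    (f : R -> V) (D : R -> V) :
  (forall t : R, is_derive t 1 f (D t)) -> continuous f.
Proof.
move=> df t; apply: differentiable_continuous.
by apply/derivable1_diffP; case: (df t).
Qed.

Lemma continuous_mulmx (R : realType) (m n p : nat) (N : 'M[R]_(m, n)) i j :
  continuous (fun M : 'M[R]_(n, p) => (N *m M) i j).
Proof.
move=> M; have -> : (fun M : 'M[R]_(n, p) => (N *m M) i j) =
    (fun M => \sum_(k < n) N i k * M k j).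
  by apply/funext => M'; rewrite mxE.
apply: (@cvg_big _ _ _ _ _ _ _ (nbhs M) _
  (fun k (M' : 'M[R]_(n, p)) => N i k * M' k j)) => [|k _].
  exact: add_continuous.
by apply: cvgMr; exact: coord_continuous.
Qed.

(** * Controllability implies the PBH test *)

(** This is w' = z w with w = u + i v and z = a + i b: since (|w|^2)' = 2 a |w|^2,
    the function |w|^2 exp(- 2 a t) is constant, hence zero. *)
Lemma rotation_eq0 (R : realType) (T a b : R) (u v : R -> R) :
  0 < T ->
  {within `[0, T], continuous u}%classic ->
  {within `[0, T], continuous v}%classic ->
  (forall t : R, 0 < t < T -> is_derive t 1 u (a * u t - b * v t)) ->
  (forall t : R, 0 < t < T -> is_derive t 1 v (b * u t + a * v t)) ->
  u 0 = 0 -> v 0 = 0 -> u T = 0 /\ v T = 0.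
Proof.
move=> T0 cu cv du dv u0 v0.
pose e t : R := expR (- (2 * a) * t).
have de (t : R) : is_derive t 1 e (- (2 * a) * e t).
  rewrite /e; apply: trigger_derive.
  by rewrite /GRing.scale /=; ring.
pose g t : R := (u t * u t + v t * v t) * e t.
have ce : {within `[0, T], continuous e}%classic.
  by apply: continuous_subspaceT; exact: (is_derive_continuous de).
have cg : {within `[0, T], continuous g}%classic.
  by move=> t; apply: cvgM; [apply: cvgD; apply: cvgM|];
    [exact: cu|exact: cu|exact: cv|exact: cv|exact: ce].
have [|c _] := @MVT_segment R g (fun=> 0) 0 T (ltW T0) _ cg.
  move=> t; rewrite in_itv /= => tT.
  have dut := du _ tT; have dvt := dv _ tT; have det := de t.
  rewrite /g; apply: is_derive_eq.
  by rewrite /GRing.scale /=; ring.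
rewrite mul0r /g u0 v0 mulr0 addr0 mul0r subr0 => /eqP.
rewrite mulf_eq0 (gt_eqF (expR_gt0 _)) orbF -!expr2.
by rewrite paddr_eq0 ?sqr_ge0// !sqrf_eq0 => /andP[/eqP-> /eqP->].
Qed.

(** The PBH test: rank [z I - A, B] = n for all z, said in terms of the left
    eigenvectors. *)
Definition uncontrolled_mode_free (F : fieldType) (n m : nat) (A : 'M[F]_n)
    (B : 'M[F]_(n, m)) : Prop :=
  forall (z : F) (q : 'rV[F]_n), q *m A = z *: q -> q *m B = 0 -> q = 0.

Lemma Re_mulmx (R : rcfType) (n m : nat) (q : 'rV[R[i]]_n) (M : 'M[R]_(n, m)) :
  map_mx (@complex.Re R) (q *m map_mx (real_complex R) M) =
  map_mx (@complex.Re R) q *m M.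
Proof.
apply/matrixP => i j; rewrite !mxE raddf_sum; apply: eq_bigr => k _.
by rewrite !mxE; case: (q i k) => x y /=; rewrite mulr0 subr0.
Qed.

Lemma Im_mulmx (R : rcfType) (n m : nat) (q : 'rV[R[i]]_n) (M : 'M[R]_(n, m)) :
  map_mx (@complex.Im R) (q *m map_mx (real_complex R) M) =
  map_mx (@complex.Im R) q *m M.
Proof.
apply/matrixP => i j; rewrite !mxE raddf_sum; apply: eq_bigr => k _.
by rewrite !mxE; case: (q i k) => x y /=; rewrite mulr0 add0r.
Qed.

Lemma row_eq0_dual (F : fieldType) (n : nat) (v : 'rV[F]_n) :
  (forall x : 'cV[F]_n, v *m x = 0) -> v = 0.
Proof.
move=> vx; apply/rowP => j.
have /matrixP/(_ 0 0) := vx (delta_mx j 0).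
by rewrite -colE !mxE.
Qed.

(** The real and imaginary parts of q x(t) form a planar system that the input
    does not enter, so they cannot leave 0. *)
Lemma controllable_uncontrolled_mode_free (R : realType) (n m : nat)
    (A : 'M[R]_n) (B : 'M[R]_(n, m)) :
  controllable A B ->
  uncontrolled_mode_free (complexify A) (map_mx (real_complex R) B).
Proof.
move=> AB z q qA qB.
pose a := map_mx (@complex.Re R) q; pose b := map_mx (@complex.Im R) q.
have aB : a *m B = 0 by rewrite -Re_mulmx qB; apply/matrixP => i j; rewrite !mxE.
have bB : b *m B = 0 by rewrite -Im_mulmx qB; apply/matrixP => i j; rewrite !mxE.
have aA : a *m A = complex.Re z *: a - complex.Im z *: b.
  rewrite -Re_mulmx [q *m _]qA; apply/matrixP => i j.
  by rewrite !mxE; case: (z) (q i j) => [? ?] [? ?].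
have bA : b *m A = complex.Im z *: a + complex.Re z *: b.
  rewrite -Im_mulmx [q *m _]qA; apply/matrixP => i j.
  by rewrite !mxE; case: (z) (q i j) => [? ?] [? ?] /=; rewrite addrC.
have ab0 (x1 : 'cV[R]_n) : a *m x1 = 0 /\ b *m x1 = 0.
  have [T [u [x [T0 _ [cx dx] x0 xT]]]] := AB 0 x1.
  have cc (c : 'rV[R]_n) :
      {within `[0, T], continuous (fun t => (c *m x t) 0 0)}%classic.
    by move=> t; exact: (cvg_comp _ _ (cx t) (@continuous_mulmx _ _ _ _ c 0 0 (x t))).
  have dc (c : 'rV[R]_n) (t : R) : c *m B = 0 -> 0 < t < T ->
      is_derive t 1 (fun t => (c *m x t) 0 0) ((c *m A *m x t) 0 0).
    move=> cB /dx /(is_derive_mulmx c) /is_derive_mx/(_ 0 0).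
    by rewrite mulmxDr !mulmxA cB mul0mx addr0.
  have [| | | |] := @rotation_eq0 R T (complex.Re z) (complex.Im z)
    (fun t => (a *m x t) 0 0) (fun t => (b *m x t) 0 0) T0 (cc a) (cc b).
  - move=> t /(dc _ _ aB).
    have -> : (a *m A *m x t) 0 0 =
        complex.Re z * (a *m x t) 0 0 - complex.Im z * (b *m x t) 0 0.
      rewrite aA mulmxBl -!scalemxAl.
      by move: (a *m x t) (b *m x t) => f g; rewrite !mxE.
    by [].
  - move=> t /(dc _ _ bB).
    have -> : (b *m A *m x t) 0 0 =
        complex.Im z * (a *m x t) 0 0 + complex.Re z * (b *m x t) 0 0.
      rewrite bA mulmxDl -!scalemxAl.
      by move: (a *m x t) (b *m x t) => f g; rewrite !mxE.
    by [].
  - by rewrite x0 mulmx0 mxE.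
  - by rewrite x0 mulmx0 mxE.
  by rewrite xT => a0 b0; split; apply/matrixP => i j; rewrite !ord1 [RHS]mxE.
have a0 : a = 0 by apply: row_eq0_dual => x; case: (ab0 x).
have b0 : b = 0 by apply: row_eq0_dual => x; case: (ab0 x).
apply/matrixP => i j.
have /matrixP/(_ i j) := a0; have /matrixP/(_ i j) := b0.
by rewrite !mxE; case: (q i j) => x y /= -> ->.
Qed.

(** * The PBH test implies controllability *)

(** The vectors v with v A^j B = 0 for all j form an A-invariant subspace.  The
    characteristic polynomial kills v and splits; multiply v by its factors
    A - z one at a time.  Just before the product first vanishes it would be an
    eigenvector in that subspace, which the PBH test excludes. *)
Lemma krylov_eq0 (F : closedFieldType) (n m : nat) (A : 'M[F]_n.+1)
    (B : 'M[F]_(n.+1, m)) (v : 'rV[F]_n.+1) :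
  uncontrolled_mode_free A B ->
  (forall j, v *m A ^+ j *m B = 0) -> v = 0.
Proof.
move=> AB vB.
have [s Es] := closed_field_poly_normal (char_poly A).
have : v *m \prod_(z <- s) (A - z%:M) = 0.
  have := Cayley_Hamilton A; rewrite Es (monicP (char_poly_monic A)) scale1r.
  rewrite rmorph_prod /= => H; rewrite -[RHS](mulmx0 _ v) -H; congr (_ *m _).
  by apply: eq_bigr => z _; rewrite rmorphB /= horner_mx_X horner_mx_C.
elim: s v vB {Es} => [|z s IHs] v vB; first by rewrite big_nil mulmx1.
rewrite big_cons mulmxA => vs.
have vA : v *m A = z *: v.
  apply/eqP; rewrite -subr_eq0 -mul_mx_scalar -mulmxBr; apply/eqP.
  apply: IHs vs => j.
  rewrite mulmxBr mulmxBl mul_mx_scalar -mulmxA -[A *m _]exprS mulmxBl vB.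
  by rewrite -!scalemxAl vB scaler0 subr0.
apply: AB vA _.
by have := vB 0%N; rewrite mulmx1.
Qed.

(** The Leibniz rule keeps the factor (X - a)^(n - k) in the k-th derivative, so
    the jet at a of a multiple of (X - a)^n starts at order n.  It makes
    prescribing derivatives a triangular problem. *)
Lemma derivn_XsubC_exp (F : comNzRingType) (a : F) (n k : nat) (h : {poly F}) :
  (k <= n)%N ->
  ((('X - a%:P) ^+ n * h)^`(k)).[a] = if k == n then h.[a] *+ n`! else 0.
Proof.
elim: k n h => [|k IHk] [|n] h //; rewrite ?derivn0.
- by rewrite expr0 mul1r.
- by rewrite exprS !hornerE subrr !mul0r.
rewrite ltnS => kn; rewrite derivSn derivM deriv_exp derivXsubC mul1r /=.
rewrite mulrnAl -mulrnAr exprSr -mulrA -mulrDr IHk// eqSS.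
case: eqP => // _.
by rewrite !hornerE subrr mul0r addr0 hornerMn -mulrnA factS mulnC.
Qed.

(** The factor h is carried along so that the interpolant can be made flat at
    another point. *)
Lemma interpolate_jet (F : numFieldType) (n : nat) (h : {poly F}) (a : F)
    (b : nat -> F) :
  h.[a] != 0 ->
  exists g : {poly F}, forall k, (k < n)%N -> (h * g)^`(k).[a] = b k.
Proof.
move=> ha; elim: n => [|n [g gP]]; first by exists 0.
pose c := (b n - (h * g)^`(n).[a]) / (h.[a] *+ n`!).
(* the correction leaves the derivatives of order < n at a unchanged *)
exists (g + ('X - a%:P) ^+ n * c%:P) => k; rewrite ltnS => kn.
rewrite mulrDr derivnD hornerD mulrCA derivn_XsubC_exp//.
case: eqP kn => [-> _|/eqP kn1 kn]; last by rewrite addr0 gP// ltn_neqAle kn1.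
rewrite hornerM hornerC -mulrnAl [_ * c]mulrC divfK; first by rewrite addrC subrK.
by rewrite mulrn_eq0 negb_or ha andbT -lt0n fact_gt0.
Qed.

(** Each of the two summands is flat to order n at the other point. *)
Lemma hermite_interpolation (F : numFieldType) (n : nat) (a0 a1 : F)
    (b0 b1 : nat -> F) :
  a0 != a1 ->
  exists y : {poly F}, forall k, (k < n)%N ->
    y^`(k).[a0] = b0 k /\ y^`(k).[a1] = b1 k.
Proof.
move=> a01.
have [|g0 g0P] := @interpolate_jet F n (('X - a1%:P) ^+ n) a0 b0.
  by rewrite !hornerE expf_neq0// subr_eq0.
have [|g1 g1P] := @interpolate_jet F n (('X - a0%:P) ^+ n) a1 b1.
  by rewrite !hornerE expf_neq0// subr_eq0 eq_sym.
exists (('X - a1%:P) ^+ n * g0 + ('X - a0%:P) ^+ n * g1) => k kn.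
rewrite derivnD !hornerD g0P// g1P//.
by rewrite !derivn_XsubC_exp ?(ltnW kn)// (ltn_eqF kn) addr0 add0r.
Qed.

(** The range of a linear map is everything when its transpose is injective. *)
Lemma sum_mulmx_surjective (F : fieldType) (N n m : nat)
    (M : 'I_N -> 'M[F]_(n, m)) (x : 'cV[F]_n) :
  (forall v : 'rV[F]_n, (forall k, v *m M k = 0) -> v = 0) ->
  exists c : 'I_N -> 'cV[F]_m, x = \sum_k M k *m c k.
Proof.
move=> M0; pose S := (\sum_k <<(M k)^T>>)%MS.
have S1 : cokermx S = 0.
  apply: trmx_inj; rewrite trmx0; apply/row_matrixP => i; rewrite row0.
  apply: M0 => k; rewrite -row_mul; apply: trmx_inj.
  suff -> : (cokermx S)^T *m M k = 0 by rewrite row0 !trmx0.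
  apply: trmx_inj; rewrite trmx_mul trmxK trmx0.
  have /eqP : (M k)^T *m cokermx S == 0.
    by rewrite -submxE (sumsmx_sup k)// genmxE.
  by [].
have /sub_sumsmxP[u ux] : (x^T <= S)%MS by rewrite submxE S1 mulmx0.
exists (fun k => (u k *m <<(M k)^T>>%MS *m pinvmx (M k)^T)^T).
apply: trmx_inj; rewrite ux linear_sum/=; apply: eq_bigr => k _.
by rewrite trmx_mul trmxK mulmxKpV// (submx_trans (submxMl _ _))// genmxE.
Qed.

(** The matrices horner_tail A k.+1 are the coefficients of adj(s I - A),
    and horner_tail_step compares the coefficients of s^k in
    (s I - A) adj(s I - A) = chi(s) I. *)
Definition horner_tail (F : comNzRingType) (n : nat) (A : 'M[F]_n.+1) (k : nat) :
    'M[F]_n.+1 :=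
  horner_mx A (drop_poly k (char_poly A)).

Lemma horner_tail_step (F : comNzRingType) (n : nat) (A : 'M[F]_n.+1) (k : nat) :
  horner_tail A k = A *m horner_tail A k.+1 + ((char_poly A)`_k)%:M.
Proof.
rewrite /horner_tail; set p := char_poly A.
have -> : drop_poly k p = 'X * drop_poly k.+1 p + (p`_k)%:P.
  apply/polyP => -[|i]; rewrite coefD coefXM coefC !coef_drop_poly/=.
    by rewrite add0r add0n.
  by rewrite addr0 addSnnS.
by rewrite rmorphD rmorphM/= horner_mx_X horner_mx_C.
Qed.

Lemma horner_tail0 (F : comNzRingType) (n : nat) (A : 'M[F]_n.+1) :
  horner_tail A 0 = 0.
Proof. by rewrite /horner_tail drop_poly0l Cayley_Hamilton. Qed.

Lemma horner_tail_lead (F : comNzRingType) (n : nat) (A : 'M[F]_n.+1) :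
  horner_tail A n.+1 = 1%:M.
Proof.
have szA : size (char_poly A) = n.+2 by rewrite size_char_poly.
rewrite horner_tail_step /horner_tail drop_poly_eq0 ?szA// rmorph0 mulmx0 add0r.
by have /monicP := char_poly_monic A; rewrite lead_coefE szA => ->.
Qed.

Lemma horner_tail_oversize (F : comNzRingType) (n k : nat) (A : 'M[F]_n.+1) :
  (n.+1 < k)%N -> horner_tail A k = 0.
Proof.
by move=> nk; rewrite /horner_tail drop_poly_eq0 ?rmorph0// size_char_poly.
Qed.

(** The rows v that annihilate every W_{k+1} B are stable under A, because
    A W_{k+1} = W_k - chi_k I, where W_0 = 0 and the last W is the identity; the
    latter also turns annihilating all W_{k+1} B into annihilating B. *)
Lemma horner_tail_krylov (F : comNzRingType) (n m : nat) (A : 'M[F]_n.+1)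
    (B : 'M[F]_(n.+1, m)) (v : 'rV[F]_n.+1) :
  (forall k : 'I_n.+1, v *m (horner_tail A k.+1 *m B) = 0) ->
  forall j, v *m A ^+ j *m B = 0.
Proof.
move=> vB.
have vW k : v *m horner_tail A k.+1 *m B = 0.
  have [kn|nk] := ltnP k n.+1; first by rewrite -mulmxA (vB (Ordinal kn)).
  by rewrite horner_tail_oversize// mulmx0 mul0mx.
suff vAW j k : v *m A ^+ j *m horner_tail A k.+1 *m B = 0.
  by move=> j; have := vAW j n; rewrite horner_tail_lead mulmx1.
elim: j k => [|j IHj] k; first by rewrite expr0 mulmx1.
have -> : v *m A ^+ j.+1 *m horner_tail A k.+1 *m B =
    v *m A ^+ j *m (horner_tail A k - ((char_poly A)`_k)%:M) *m B.
  by rewrite [horner_tail A k]horner_tail_step addrK exprSr !mulmxA.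
rewrite mulmxBr mulmxBl mul_mx_scalar -scalemxAl.
have -> : v *m A ^+ j *m B = 0.
  by have := IHj n; rewrite horner_tail_lead mulmx1.
rewrite scaler0 subr0; case: k => [|k]; last exact: IHj.
by rewrite horner_tail0 mulmx0 mul0mx.
Qed.

(** Flat parametrization of the trajectories: for every y, the pair
    x = adj(d/dt - A) B y, u = chi(d/dt) y solves the equation.  Polynomials y
    suffice to join two given states in unit time. *)
Lemma krylov_controllable (R : realType) (n m : nat) (A : 'M[R]_n.+1)
    (B : 'M[R]_(n.+1, m)) :
  (forall v : 'rV[R]_n.+1, (forall j, v *m A ^+ j *m B = 0) -> v = 0) ->
  controllable A B.
Proof.
move=> AB x0 x1.
pose W (k : nat) := horner_tail A k.+1 *m B.
have W_surj x : exists c : 'I_n.+1 -> 'cV[R]_m, x = \sum_(k < n.+1) W k *m c k.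
  by apply: sum_mulmx_surjective => v /horner_tail_krylov; exact: AB.
have [[c0 c0P] [c1 c1P]] := (W_surj x0, W_surj x1).
have /choice[Y YP] (j : 'I_m) : exists Yj : {poly R}, forall k, (k < n.+1)%N ->
    Yj^`(k).[0] = c0 (inord k) j 0 /\ Yj^`(k).[1] = c1 (inord k) j 0.
  apply: (@hermite_interpolation _ n.+1 0 1 (fun k => c0 (inord k) j 0)).
  by rewrite eq_sym oner_neq0.
pose y k (t : R) : 'cV[R]_m := \col_j (Y j)^`(k).[t].
have dy k (t : R) : is_derive t 1 (y k) (y k.+1 t).
  apply/is_derive_mx => j l; rewrite mxE.
  have -> : (fun s => y k s j l) = horner (Y j)^`(k).
    by apply/funext => s; rewrite mxE.
  exact: is_derive_poly.
pose x (t : R) := \sum_(k < n.+1) W k *m y k t.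
pose u (t : R) := \sum_(k < n.+2) (char_poly A)`_k *: y k t.
have dx (t : R) : is_derive t 1 x (\sum_(k < n.+1) W k *m y k.+1 t).
  have -> : x = \sum_(k < n.+1) (fun s => W k *m y k s).
    by apply/funext => s; rewrite fct_sumE.
  by apply: is_derive_sum => k; exact: is_derive_mulmx.
have du (t : R) : is_derive t 1 u (\sum_(k < n.+2) (char_poly A)`_k *: y k.+1 t).
  have -> : u = \sum_(k < n.+2) ((char_poly A)`_k \*: y k).
    by apply/funext => s; rewrite fct_sumE.
  by apply: is_derive_sum => k; exact: is_deriveZ.
have ode (t : R) : \sum_(k < n.+1) W k *m y k.+1 t = A *m x t + B *m u t.
  have chi1 : (char_poly A)`_n.+1 = 1.
    by have /monicP := char_poly_monic A; rewrite lead_coefE size_char_poly.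
  rewrite [u t]big_ord_recr/= chi1 scale1r mulmxDr addrA.
  (* the k-th terms combine to W_k B y^(k), a shift of the sum for x' *)
  have -> : A *m x t + B *m (\sum_(k < n.+1) (char_poly A)`_k *: y k t) =
      \sum_(k < n.+1) horner_tail A k *m B *m y k t.
    rewrite !mulmx_sumr -big_split/=; apply: eq_bigr => k _.
    rewrite [horner_tail A k]horner_tail_step !mulmxDl !mulmxA.
    by rewrite mul_scalar_mx -!scalemxAl -scalemxAr.
  rewrite big_ord_recr big_ord_recl/= horner_tail0 !mul0mx add0r.
  by rewrite [in W n]/W horner_tail_lead mul1mx.
exists 1, u, x; split=> //.
- by apply: continuous_subspaceT; exact: (is_derive_continuous du).
- split; first by apply: continuous_subspaceT; exact: (is_derive_continuous dx).
  by move=> t _; rewrite -ode.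
- rewrite c0P; apply: eq_bigr => k _; congr (_ *m _); apply/colP => j.
  by rewrite mxE (proj1 (YP _ _ _))// inord_val.
- rewrite c1P; apply: eq_bigr => k _; congr (_ *m _); apply/colP => j.
  by rewrite mxE (proj2 (YP _ _ _))// inord_val.
Qed.

Lemma uncontrolled_mode_free_controllable (R : realType) (n m : nat)
    (A : 'M[R]_n) (B : 'M[R]_(n, m)) :
  (0 < n)%N ->
  uncontrolled_mode_free (complexify A) (map_mx (real_complex R) B) ->
  controllable A B.
Proof.
case: n A B => // n A B _ AB; apply: krylov_controllable => v vB.
apply: (map_mx_inj (f := real_complex R)); rewrite map_mx0.
apply: krylov_eq0 AB _ => j.
by rewrite -rmorphXn -!map_mxM vB map_mx0.
Qed.

(** * Index sets in H and the lower bound *)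

(** The right-hand side says that the rows of X indexed by Xa span; a basis
    extracted from them is a member of H X.  In this form the condition no
    longer chooses an index set. *)
Lemma H_subsetP (F : fieldType) (n k : nat) (X : 'M[F]_(n, k)) (Xa : {set 'I_n}) :
  (exists h : {set 'I_n}, h \in H X /\ h \subset Xa) <->
  (forall c : 'rV[F]_k, (forall j, j \in Xa -> (c *m X^T) 0 j = 0) -> c = 0).
Proof.
have colsE (c : 'rV[F]_k) (J : {set 'I_n}) j :
    (c *m cols_of X^T J) 0 j = (c *m X^T) 0 (enum_val j).
  by rewrite !mxE; apply: eq_bigr => i _; rewrite !mxE.
split=> [[h [+ /fintype.subsetP hXa]] c cX|X0].
  rewrite inE => /andP[_ /row_free_inj hfree]; apply: hfree.
  rewrite mul0mx; apply/rowP => j.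
  by rewrite colsE cX ?mxE// hXa// enum_valP.
pose M := rowsub (fun j : 'I_#|Xa| => enum_val j) X.
have cM (c : 'rV[F]_k) : c *m M^T = 0 -> c = 0.
  move=> cM0; apply: X0 => j jXa.
  have /rowP/(_ (enum_rank_in jXa j)) := cM0.
  rewrite [RHS]mxE => <-; rewrite !mxE; apply: eq_bigr => i _.
  by rewrite !mxE enum_rankK_in.
have rM : \rank M = k by rewrite -mxrank_tr; apply/eqP/inj_row_free.
pose f i : 'I_n := enum_val (maxrankfun M i).
have f_inj : injective f by move=> i j /enum_val_inj/maxrankfun_inj.
exists [set f i | i : 'I_(\rank M)]%SET; split; last first.
  by apply/fintype.subsetP => _ /imsetP[i _ ->]; exact: enum_valP.
rewrite inE; apply/andP; split; first by rewrite card_imset// card_ord rM.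
apply: inj_row_free => c cJ.
have cf i : (c *m X^T) 0 (f i) = 0.
  have fi : f i \in [set f i | i : 'I_(\rank M)]%SET by apply: imset_f.
  have /rowP/(_ (enum_rank_in fi (f i))) := cJ.
  by rewrite colsE enum_rankK_in// [RHS]mxE.
apply: cM; have /submxP[D ->] : (M <= rowsub (maxrankfun M) M)%MS.
  by rewrite eq_maxrowsub.
rewrite trmx_mul mulmxA (_ : c *m _ = 0) ?mul0mx//.
apply/rowP => i; rewrite [RHS]mxE -(cf i) !mxE.
by apply: eq_bigr => j _; rewrite !mxE.
Qed.

(** Deleting the zero columns does not change the column space. *)
Lemma rank_le_num_inputs (R : realType) (n m : nat) (B : 'M[R]_(n, m)) :
  (\rank B <= num_inputs B)%N.
Proof.
pose J := [set j : 'I_m | col j B != 0]%SET.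
have BE : B = colsub (fun j : 'I_#|J| => enum_val j) B *m
    rowsub (fun j : 'I_#|J| => enum_val j) 1%:M.
  apply/matrixP => i j; rewrite mxE.
  have [jJ|jJ] := boolP (j \in J).
    rewrite (bigD1 (enum_rank_in jJ j))//= !mxE enum_rankK_in// eqxx mulr1.
    rewrite big1 ?addr0// => l lj; rewrite !mxE.
    case: eqP => [lj'|_]; last by rewrite mulr0.
    by case/eqP: lj; apply: enum_val_inj; rewrite enum_rankK_in.
  have /eqP/colP/(_ i) : col j B == 0 by move: jJ; rewrite inE negbK.
  rewrite !mxE => ->; rewrite big1// => l _; rewrite !mxE.
  case: eqP => [lj|_]; last by rewrite mulr0.
  by move: (enum_valP l); rewrite lj (negbTE jJ).
by rewrite {1}BE (leq_trans (mxrankM_maxl _ _))// rank_leq_col.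
Qed.

(** * A matrix B with the least number of columns *)

Lemma rank_row_mx_gt (F : fieldType) (k l : nat) (P : 'M[F]_(k, l))
    (q : 'cV[F]_k) (c : 'rV[F]_k) :
  c *m P = 0 -> c *m q != 0 -> (\rank P < \rank (row_mx q P))%N.
Proof.
move=> cP cq; rewrite -mxrank_tr -[X in (_ < X)%N]mxrank_tr tr_row_mx.
apply: rank_ltmx; rewrite ltmxE -addsmxE addsmxSr -addsmxE.
apply: contra cq; rewrite addsmx_sub => /andP[/submxP[D qD] _].
have -> : q = P *m D^T by apply: trmx_inj; rewrite qD trmx_mul trmxK.
by rewrite mulmxA cP mul0mx.
Qed.

Lemma nat_nonroot (F : numDomainType) (P : {poly F}) :
  P != 0 -> exists t : nat, P.[t%:R] != 0.
Proof.
move=> P0; pose s := [seq t%:R : F | t <- iota 0 (size P)].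
have /allPn[_ /mapP[t _ ->]] : ~~ all (root P) s.
  have s_uniq : uniq s.
    by rewrite map_inj_uniq ?iota_uniq// => t u /eqP; rewrite eqr_nat => /eqP.
  apply/negP => /(max_poly_roots P0)/(_ s_uniq).
  by rewrite size_map size_iota ltnn.
by exists t.
Qed.

(** Along the real moment curve b(t) = (t^j) restricted to Xa, each w_i b(t) is a
    polynomial in t whose coefficients are the entries of w_i, so an integer t
    that is not a root of the product of the nonzero ones works for all i.
    Hence a single real vector avoids all the complex hyperplanes at once. *)
Lemma moment_curve_avoids (R : rcfType) (n p : nat) (Xa : {set 'I_n})
    (w : 'I_p -> 'rV[R[i]]_n) :
  exists b : 'cV[R]_n, (forall j, j \notin Xa -> b j 0 = 0) /\
    forall i, (exists2 j, j \in Xa & w i 0 j != 0) ->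
      w i *m map_mx (real_complex R) b != 0.
Proof.
pose P i : {poly R[i]} := \sum_(j < n | j \in Xa) w i 0 j *: 'X^j.
have coefP i (j : 'I_n) : j \in Xa -> (P i)`_j = w i 0 j.
  move=> jXa; rewrite coef_sum (bigD1 j)//= coefZ coefXn eqxx mulr1.
  rewrite big1 ?addr0// => l /andP[_ lj]; rewrite coefZ coefXn.
  by rewrite (inj_eq val_inj) eq_sym (negbTE lj) mulr0.
have [|t Pt] := @nat_nonroot _ (\prod_(i < p | P i != 0) P i).
  exact/prodf_neq0.
exists (\col_j if j \in Xa then t%:R ^+ j else 0); split=> [j /negbTE jXa|i].
  by rewrite mxE jXa.
case=> j jXa wj; have Pi0 : P i != 0.
  by apply: contra wj => /eqP Pi; rewrite -coefP// Pi coef0.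
have : (P i).[t%:R] != 0.
  by move: Pt; rewrite (bigD1 i)//= hornerM mulf_eq0 negb_or => /andP[].
apply: contra => /eqP/matrixP/(_ 0 0); rewrite !mxE => wb.
rewrite -[X in _ == X]wb horner_sum big_mkcond/=; apply/eqP.
apply: eq_bigr => l _; rewrite !mxE hornerZ hornerXn.
by case: ifP => _; rewrite ?rmorphXn ?rmorph_nat ?rmorph0 ?mulr0.
Qed.

(** As long as M_i B has rank below k_i, some c != 0 kills it; then c M_i is
    nonzero somewhere on Xa, and any new column b with c M_i b != 0 raises the
    rank.  One b serves all such i by moment_curve_avoids. *)
Lemma generic_actuation (R : rcfType) (n p : nat) (k : 'I_p -> nat)
    (M : forall i, 'M[R[i]]_(k i, n)) (Xa : {set 'I_n}) (l : nat) :
  (forall i (c : 'rV_(k i)), (forall j, j \in Xa -> (c *m M i) 0 j = 0) -> c = 0) ->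
  exists B : 'M[R]_(n, l), (forall i j, i \notin Xa -> B i j = 0) /\
    forall i, (minn l (k i) <= \rank (M i *m map_mx (real_complex R) B))%N.
Proof.
move=> MXa; elim: l => [|l [B [BXa Brank]]].
  by exists 0; split=> [i []//|i]; rewrite min0n.
pose Bc := map_mx (real_complex R) B.
have /choice[w wP] (i : 'I_p) : exists w : 'rV[R[i]]_n,
    (\rank (M i *m Bc) < k i)%N ->
    (exists2 j, j \in Xa & w 0 j != 0) /\
    exists2 c : 'rV_(k i), w = c *m M i & c *m (M i *m Bc) = 0.
  have [rk|rk] := ltnP (\rank (M i *m Bc)) (k i); last by exists 0.
  have /rowV0Pn[c /sub_kermxP cMB c0] : kermx (M i *m Bc) != 0.
    by rewrite kermx_eq0 /row_free neq_ltn rk.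
  exists (c *m M i) => _; split; last by exists c.
  apply/exists_inP; apply: contraR c0; rewrite negb_exists => /forallP cM.
  apply/eqP/MXa => j jXa; apply/eqP.
  by have := cM j; rewrite jXa negbK.
have [b [bXa wb]] := moment_curve_avoids Xa w.
(* the new column comes first, 1 + l being convertible to l.+1 *)
exists (row_mx b B : 'M[R]_(n, 1 + l)); split=> [i j iXa|i].
  by rewrite mxE; case: (@fintype.split 1 l j) => j'; rewrite ?ord1 ?bXa ?BXa.
suff : (minn l.+1 (k i) <=
    \rank (row_mx (M i *m map_mx (real_complex R) b) (M i *m Bc)))%N.
  by rewrite -mul_mx_row -map_row_mx.
have [rk|rk] := ltnP (\rank (M i *m Bc)) (k i).
  have [wXa [c wE cMB]] := wP i rk.
  apply: leq_trans (rank_row_mx_gt cMB _); last by rewrite mulmxA -wE wb.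
  have := Brank i; rewrite -/Bc !geq_min [(k i <= _)%N]leqNgt rk orbF => lB.
  by rewrite ltnS lB.
apply: (leq_trans (geq_minr _ _)); apply: (leq_trans rk).
by rewrite -mxrank_tr -[X in (_ <= X)%N]mxrank_tr tr_row_mx -addsmxE mxrankS ?addsmxSr.
Qed.

(** * The PBH test in terms of the left null bases *)

Lemma left_null_basisP (R : realType) (n k : nat) (A : 'M[R]_n) (z : R[i])
    (X : 'M[R[i]]_(n, k)) (q : 'rV[R[i]]_n) :
  left_null_basis A z X ->
  q *m complexify A = z *: q <-> (exists c : 'rV_k, q = c *m X^T).
Proof.
case=> _ /eqmxP Xker.
have kerP : q *m complexify A = z *: q <-> (q <= kermx (z%:M - complexify A))%MS.
  rewrite -mul_mx_scalar; split=> [qA|/sub_kermxP/eqP].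
    by apply/sub_kermxP; rewrite mulmxBr qA subrr.
  by rewrite mulmxBr subr_eq0 => /eqP.
by split=> [/kerP|qX]; [|apply/kerP; move: qX]; rewrite -Xker => /submxP.
Qed.

Lemma uncontrolled_mode_free_row_free (R : realType) (n m k : nat) (A : 'M[R]_n)
    (B : 'M[R[i]]_(n, m)) (z : R[i]) (X : 'M[R[i]]_(n, k)) :
  left_null_basis A z X -> uncontrolled_mode_free (complexify A) B ->
  row_free (X^T *m B).
Proof.
move=> Xz AB; apply: inj_row_free => c; rewrite mulmxA => cXB.
have cX0 : c *m X^T = 0.
  by apply: AB cXB; apply/(left_null_basisP _ Xz); exists c.
by apply: (row_free_inj (proj1 Xz)); rewrite mul0mx.
Qed.

Lemma row_free_uncontrolled_mode_free (R : realType) (n m p : nat)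
    (A : 'M[R]_n) (lambda : 'I_p -> R[i]) (k : 'I_p -> nat)
    (X : forall i, 'M[R[i]]_(n, k i)) (B : 'M[R[i]]_(n, m)) :
  (forall z, eigenvalue (complexify A) z -> exists i, lambda i = z) ->
  (forall i, left_null_basis A (lambda i) (X i)) ->
  (forall i, row_free ((X i)^T *m B)) ->
  uncontrolled_mode_free (complexify A) B.
Proof.
move=> eigA Xl XB z q qA qB; have [->//|q0] := eqVneq q 0.
have [i iz] : exists i, lambda i = z.
  by apply: eigA; apply/eigenvalueP; exists q.
move: qA qB {q0}; rewrite -iz => /(left_null_basisP _ (Xl i))[c ->] cXB.
suff -> : c = 0 by rewrite mul0mx.
by apply: (row_free_inj (XB i)); rewrite mul0mx mulmxA.
Qed.

Theorem theorem3 (R : realType) (n : nat) (n_gt0 : (0 < n)%N) (A : 'M[R]_n)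
    (p : nat) (lambda : 'I_p -> R[i])
    (lambda_distinct : injective lambda)
    (lambda_eigenvalues : forall z : R[i],
        eigenvalue (complexify A) z <-> exists i : 'I_p, lambda i = z)
    (X : forall i : 'I_p, 'M[R[i]]_(n, geom_mult A (lambda i)))
    (X_basis : forall i : 'I_p, left_null_basis A (lambda i) (X i))
    (Xa : {set 'I_n}) :
  ((exists (m : nat) (B : 'M[R]_(n, m)), feasible A Xa B) ->
     forall i : 'I_p, exists h : {set 'I_n}, h \in H (X i) /\ h \subset Xa)
  /\
  ((forall i : 'I_p, exists h : {set 'I_n}, h \in H (X i) /\ h \subset Xa) ->
     minimal_num_inputs A Xa (\max_(i < p) geom_mult A (lambda i))%N).
Proof.
have feasible_row_free m (B : 'M[R]_(n, m)) i : feasible A Xa B ->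
    row_free ((X i)^T *m map_mx (real_complex R) B).
  by case=> /controllable_uncontrolled_mode_free AB _;
    exact: uncontrolled_mode_free_row_free (X_basis i) AB.
have lower_bound m (B : 'M[R]_(n, m)) : feasible A Xa B ->
    (\max_(i < p) geom_mult A (lambda i) <= num_inputs B)%N.
  move=> feasB; apply/bigmax_leqP => i _.
  rewrite -(eqP (feasible_row_free _ _ i feasB)).
  by rewrite (leq_trans (mxrankM_maxr _ _))// mxrank_map rank_le_num_inputs.
split=> [[m [B feasB]] i|Xa_meets].
  apply/H_subsetP => c cXa; apply: (row_free_inj (feasible_row_free _ _ i feasB)).
  rewrite mul0mx mulmxA; apply/rowP => j; rewrite mxE [RHS]mxE big1// => l _.
  have [lXa|lXa] := boolP (l \in Xa); first by rewrite cXa ?mul0r.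
  rewrite [map_mx _ _ _ _]mxE (_ : B l j = 0) ?rmorph0 ?mulr0//.
  have /eqP/rowP/(_ j) : row l B == 0 by apply: contraR lXa => /feasB.2.
  by rewrite !mxE.
set kmax := (\max_(i < p) _)%N.
have [B [BXa Brank]] := generic_actuation kmax
  (fun i => (H_subsetP (X i) Xa).1 (Xa_meets i)).
have feasB : feasible A Xa B.
  split; last first.
    move=> i; apply: contraR => iXa; apply/eqP/rowP => j.
    by rewrite !mxE BXa.
  apply: uncontrolled_mode_free_controllable => //.
  apply: (row_free_uncontrolled_mode_free _ X_basis) => [z /lambda_eigenvalues//|i].
  rewrite /row_free eqn_leq rank_leq_row.
  by rewrite (leq_trans _ (Brank i))// leq_min leqnn andbT leq_bigmax.
split=> //; exists kmax, B; split=> //.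
apply/eqP; rewrite eqn_leq lower_bound// andbT.
by rewrite (leq_trans (max_card _))// card_ord.
Qed.
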